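(* Let $l\ge 0$ be an integer. Let $A\in \mathrm{GL}_n(k((z)))$ have dominant coweight $\rho(A)=(l)=(l,0^{n-1})$ and let $B\in\mathrm{GL}_n(k((z)))$. Write the symmetric coweights as $\sigma(B)=(a_1,\dots,a_n)$ and $\sigma(AB)=(b_1,\dots,b_n)$, in decreasing order. Then $a_{i+1}\le b_i\le a_{i-1}$ for all $i$ (where the inequality $a_{i+1}\le b_i$ is asserted for $1\le i\le n-1$ and $b_i\le a_{i-1}$ for $2\le i\le n$).
   Context: $k$ is a finite field with $\mathrm{char}(k)\ne 2$. Let $G=\mathrm{GL}_n(k((z)))$, $K=\mathrm{GL}_n(k[[z]])$, $H=\mathrm{GL}_n(k((z^2)))$. Dominant coweight: every $g\in G$ lies in $K\,\mathrm{diag}(z^{\lambda_1},\dots,z^{\lambda_n})\,K$ for a unique sequence of integers $\lambda_1\ge\dots\ge\lambda_n$; put $\rho(g)=(\lambda_1,\dots,\lambda_n)$. Strings of zeros in such sequences may be omitted when writing them. Symmetric coweight: every $g\in G$ lies in $K\Lambda H$ for a block diagonal matrix $\Lambda$ with diagonal blocks among $(1)$, $(z)$, $\begin{pmatrix}1&z\\0&z^i\end{pmatrix}$ ($i>1$), and $\Lambda$ is unique up to the order of the blocks. The symmetric coweight $\sigma(g)$ is the decreasing sequence of length $n$ obtained by letting each block $(1)$ contribute $0$, each block $(z)$ contribute $1$, and each block $\begin{pmatrix}1&z\\0&z^i\end{pmatrix}$ contribute $i$ and $0$. *)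

(* Defs.v *)
From HB Require Import structures.
From mathcomp Require Import all_boot all_order all_algebra.
From mathcomp Require Import boolp classical_sets functions cardinality fsbigop.
From mathcomp Require Import zify.

Set Implicit Arguments.
Unset Strict Implicit.
Unset Printing Implicit Defensive.

Import Order.TTheory GRing.Theory Num.Theory.
Local Open Scope ring_scope.

(* The field k((z)): the coefficient function i |-> [z^i] f of a formal
   Laurent series vanishes for all sufficiently negative i. *)
Record laurent (k : fieldType) := Laurent {
  lcoef :> int -> k;
  laurentP : exists N : int, forall i, i < N -> lcoef i = 0
}.

Lemma int_offset (N m : int) : N <= m -> exists p : nat, m = N + p%:Z.
Proof. by move=> Nm; exists (absz (m - N)%R); lia. Qed.

Section LaurentField.

Variable k : fieldType.
Implicit Types f g h : laurent k.

Lemma laurent_ext f g : (forall i, f i = g i) -> f = g.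
Proof.
case: f g => [f Pf] [g Pg] /= /funext fg.
by move: Pf; rewrite fg => Pf; congr Laurent; apply: Prop_irrelevance.
Qed.

HB.instance Definition _ := gen_eqMixin (laurent k).
HB.instance Definition _ := gen_choiceMixin (laurent k).

Lemma laurent2P f g :
  exists N : int, (forall i, i < N -> f i = 0) /\ (forall i, i < N -> g i = 0).
Proof.
have [[N fN] [M gM]] := (laurentP f, laurentP g).
by exists (Order.min N M); split=> i; rewrite lt_min => /andP[iN iM];
  [exact: fN | exact: gM].
Qed.

Fact lmonom_subproof (c : k) (m : int) :
  exists N : int, forall i, i < N -> (if i == m then c else 0) = 0.
Proof. by exists m => i im; case: eqP => // ?; lia. Qed.
Definition lmonom (c : k) (m : int) : laurent k := Laurent (lmonom_subproof c m).

Fact lopp_subproof f : exists N : int, forall i, i < N -> - f i = 0.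
Proof. by have [N fN] := laurentP f; exists N => i iN; rewrite fN ?oppr0. Qed.
Definition lopp f : laurent k := Laurent (lopp_subproof f).

Fact ladd_subproof f g : exists N : int, forall i, i < N -> f i + g i = 0.
Proof.
have [N [fN gN]] := laurent2P f g.
by exists N => i iN; rewrite fN ?gN ?addr0.
Qed.
Definition ladd f g : laurent k := Laurent (ladd_subproof f g).

Fact laddA : associative ladd.
Proof. by move=> f g h; apply: laurent_ext => i /=; rewrite addrA. Qed.
Fact laddC : commutative ladd.
Proof. by move=> f g; apply: laurent_ext => i /=; rewrite addrC. Qed.
Fact ladd0 : left_id (lmonom 0 0) ladd.
Proof. by move=> f; apply: laurent_ext => i /=; rewrite if_same add0r. Qed.
Fact laddN : left_inverse (lmonom 0 0) lopp ladd.
Proof. by move=> f; apply: laurent_ext => i /=; rewrite if_same addNr. Qed.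

HB.instance Definition _ :=
  GRing.isZmodule.Build (laurent k) laddA laddC ladd0 laddN.

Lemma lcoef0 i : (0 : laurent k) i = 0.
Proof. exact: if_same. Qed.
Lemma lcoefD f g i : (f + g) i = f i + g i.
Proof. by []. Qed.
Lemma lcoefN f i : (- f) i = - f i.
Proof. by []. Qed.
Lemma lcoef_sum (I : Type) (r : seq I) (P : pred I) (F : I -> laurent k) i :
  (\sum_(j <- r | P j) F j) i = \sum_(j <- r | P j) F j i.
Proof.
by apply: (big_morph (fun f : laurent k => f i)) => //; exact: lcoef0.
Qed.

(* For Laurent series the summand has finite support, so this finitely
   supported sum over all integers is the usual Cauchy product. *)
Definition cauchy_prod (f g : int -> k) (m : int) : k :=
  \sum_(i \in [set: int]) (f i * g (m - i)).

Lemma cauchy_prod_lt (f g : int -> k) (N M m : int) :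
    (forall i, i < N -> f i = 0) -> (forall i, i < M -> g i = 0) ->
  m < N + M -> cauchy_prod f g m = 0.
Proof.
move=> fN gM mNM; apply: fsbig1 => i _.
have [/fN->|Ni] := ltP i N; first by rewrite mul0r.
by rewrite gM ?mulr0 //; lia.
Qed.

Lemma cauchy_prodE (f g : int -> k) (N M : int) (p : nat) :
    (forall i, i < N -> f i = 0) -> (forall i, i < M -> g i = 0) ->
  cauchy_prod f g (N + M + p%:Z) =
  \sum_(j < p.+1) f (N + j%:Z) * g (M + (p - j)%N%:Z).
Proof.
move=> fN gM; rewrite /cauchy_prod.
rewrite -(big_mkord xpredT (fun j => f (N + j%:Z) * g (M + (p - j)%N%:Z))) /=.
rewrite (fsbigE [seq N + j%:Z | j <- index_iota 0 p.+1]).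
- rewrite big_map big_mkcond /=; apply: eq_big_nat => j jp.
  by rewrite in_setT; congr (_ * g _); lia.
- by rewrite map_inj_uniq ?iota_uniq // => i j; lia.
- by [].
move=> i _ /mapP ir.
have [/fN->|Ni] := ltP i N; first by rewrite mul0r.
have [im|im] := ltP (N + M + p%:Z - i) M; first by rewrite gM ?mulr0.
case: ir; exists (absz (i - N)%R); last by lia.
by rewrite mem_index_iota; lia.
Qed.

Fact lmul_subproof f g : exists N : int, forall i, i < N -> cauchy_prod f g i = 0.
Proof.
have [[N fN] [M gM]] := (laurentP f, laurentP g).
by exists (N + M) => i; exact: cauchy_prod_lt.
Qed.
Definition lmul f g : laurent k := Laurent (lmul_subproof f g).

Definition ltrunc (N : int) (L : nat) f : {poly k} := \poly_(i < L) f (N + i%:Z).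

Lemma lmul_trunc f g (N M : int) (p L : nat) :
    (forall i, i < N -> f i = 0) -> (forall i, i < M -> g i = 0) -> (p < L)%N ->
  lmul f g (N + M + p%:Z) = (ltrunc N L f * ltrunc M L g)`_p.
Proof.
move=> fN gM pL; rewrite /= cauchy_prodE // coefM; apply: eq_bigr => j _.
by rewrite !coef_poly !ifT //; have := ltn_ord j; lia.
Qed.

Lemma ltrunc_mul f g (N M : int) (p L : nat) :
    (forall i, i < N -> f i = 0) -> (forall i, i < M -> g i = 0) -> (p < L)%N ->
  (ltrunc (N + M) L (lmul f g))`_p = (ltrunc N L f * ltrunc M L g)`_p.
Proof. by move=> fN gM pL; rewrite coef_poly pL (lmul_trunc (L := L)). Qed.

Fact lmulC : commutative lmul.
Proof.
move=> f g; apply: laurent_ext => m.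
have [[N fN] [M gM]] := (laurentP f, laurentP g).
have [mNM|NMm] := ltP m (N + M).
  by rewrite /= (cauchy_prod_lt fN gM mNM) (cauchy_prod_lt gM fN) //; lia.
have [p ->] := int_offset NMm.
rewrite (lmul_trunc fN gM (ltnSn _)) [N + M]addrC.
by rewrite (lmul_trunc gM fN (ltnSn _)) mulrC.
Qed.

Fact lmulA : associative lmul.
Proof.
move=> f g h; apply: laurent_ext => m.
have [[N fN] [M gM] [P hP]] := And3 (laurentP f) (laurentP g) (laurentP h).
have fgP i : i < N + M -> lmul f g i = 0 by exact: cauchy_prod_lt.
have ghP i : i < M + P -> lmul g h i = 0 by exact: cauchy_prod_lt.
have [mNMP|NMPm] := ltP m (N + M + P).
  transitivity (0 : k); last by apply/esym/(cauchy_prod_lt fgP hP).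
  by apply: (cauchy_prod_lt fN ghP); rewrite addrA.
have [p ->] := int_offset NMPm.
rewrite (lmul_trunc fgP hP (ltnSn p)).
rewrite -[N + M + P]addrA (lmul_trunc fN ghP (ltnSn p)).
transitivity (ltrunc N p.+1 f * (ltrunc M p.+1 g * ltrunc P p.+1 h))`_p.
  rewrite !(coefM (ltrunc N _ f)); apply: eq_bigr => j _.
  by rewrite ltrunc_mul //; have := ltn_ord j; lia.
rewrite mulrA !(coefM _ (ltrunc P _ h)); apply: eq_bigr => j _.
by rewrite ltrunc_mul //; have := ltn_ord j; lia.
Qed.

Lemma lmonom_mulE (c : k) (N m : int) f : lmul (lmonom c N) f m = c * f (m - N).
Proof.
rewrite /= /cauchy_prod (fsbigE [:: N]) //=; first by rewrite big_cons big_nil in_setT eqxx addr0.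
by move=> i _; rewrite inE => /negbTE->; rewrite mul0r.
Qed.

Fact lmul1 : left_id (lmonom 1 0) lmul.
Proof.
by move=> f; apply: laurent_ext => m; rewrite lmonom_mulE mul1r subr0.
Qed.

Fact lmulDl : left_distributive lmul ladd.
Proof.
move=> f g h; apply: laurent_ext => m.
have [[N [fN gN]] [M hM]] := (laurent2P f g, laurentP h).
have fgN i : i < N -> ladd f g i = 0 by move=> iN; rewrite /= fN ?gN ?addr0.
have [mNM|NMm] := ltP m (N + M).
  rewrite /= (cauchy_prod_lt fN hM mNM) (cauchy_prod_lt gN hM mNM) addr0.
  exact: (cauchy_prod_lt fgN hM mNM).
have [p ->] := int_offset NMm.
rewrite /= (cauchy_prodE _ fN hM) (cauchy_prodE _ gN hM).
rewrite (cauchy_prodE _ fgN hM) -big_split /=.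
by apply: eq_bigr => j _; rewrite mulrDl.
Qed.

Fact lone_neq0 : lmonom 1 0 != 0 :> laurent k.
Proof.
apply/eqP => /(congr1 (fun f : laurent k => f 0)); rewrite lcoef0 /=.
exact/eqP/oner_neq0.
Qed.

HB.instance Definition _ := GRing.Zmodule_isComNzRing.Build (laurent k)
  lmulA lmulC lmul1 lmulDl lone_neq0.

Lemma lcoef1 i : (1 : laurent k) i = (i == 0)%:R.
Proof. by rewrite /=; case: eqP. Qed.

Lemma lcoefM f g (N M : int) (p : nat) :
    (forall i, i < N -> f i = 0) -> (forall i, i < M -> g i = 0) ->
  (f * g) (N + M + p%:Z) =
  \sum_(j < p.+1) f (N + j%:Z) * g (M + (p - j)%N%:Z).
Proof. exact: cauchy_prodE. Qed.

Lemma lcoefM_lt f g (N M m : int) :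
    (forall i, i < N -> f i = 0) -> (forall i, i < M -> g i = 0) ->
  m < N + M -> (f * g) m = 0.
Proof. exact: cauchy_prod_lt. Qed.

Lemma lcoef_monomM (c : k) (N m : int) f : (lmonom c N * f) m = c * f (m - N).
Proof. exact: lmonom_mulE. Qed.

Lemma lmonomM (c d : k) (N M : int) :
  lmonom c N * lmonom d M = lmonom (c * d) (N + M).
Proof.
apply: laurent_ext => m; rewrite lcoef_monomM /=.
by rewrite subr_eq addrC; case: eqP => // _; rewrite mulr0.
Qed.

Lemma lcoefX_lt f (i : nat) (m : int) :
  (forall j, j < 1 -> f j = 0) -> m < i%:Z -> (f ^+ i) m = 0.
Proof.
move=> f1; elim: i m => [|i IHi] m mi.
  by rewrite expr0 lcoef1; case: eqP => // m0; lia.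
by rewrite exprS (@lcoefM_lt f (f ^+ i) 1 i%:Z) //; lia.
Qed.

Lemma geom_inv f : (forall j, j < 1 -> f j = 0) -> exists g, (1 - f) * g = 1.
Proof.
move=> f1; pose S (p : nat) : laurent k := \sum_(i < p.+1) f ^+ i.
pose gc (m : int) : k := if m is Posz p then S p p%:Z else 0.
have gP : exists N : int, forall i, i < N -> gc i = 0 by exists 0 => -[].
have S_lt p i : i < 0 -> S p i = 0.
  by move=> i0; rewrite /S lcoef_sum big1 // => j _; apply: lcoefX_lt => //; lia.
have f_lt i : i < 0 -> (1 - f) i = 0.
  move=> i0; rewrite lcoefD lcoefN lcoef1 f1 ?subr0; last by lia.
  by case: eqP => // ?; lia.
exists (Laurent gP); apply: laurent_ext => m.
have [m0|m0] := ltP m 0.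
  rewrite (lcoefM_lt (N := 0) (M := 0)) ?addr0 //; last by case.
  by rewrite lcoef1; case: eqP => // ?; lia.
have [p mp] := int_offset m0.
have {m0 mp} -> : m = 0 + 0 + p%:Z by rewrite mp.
rewrite lcoefM //; last by case.
transitivity (((1 - f) * S p) (0 + 0 + p%:Z)).
  rewrite lcoefM //; last by move=> i; apply: S_lt.
  apply: eq_bigr => j _; congr (_ * _); rewrite !add0r /= /S !lcoef_sum.
  have jp : ((p - j).+1 <= p.+1)%N by lia.
  rewrite -(big_mkord xpredT (fun i => (f ^+ i) (p - j)%N%:Z)).
  rewrite -[RHS](big_mkord xpredT (fun i => (f ^+ i) (p - j)%N%:Z)).
  rewrite [RHS](big_cat_nat (n := (p - j).+1)) //= [X in _ = _ + X]big_nat.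
  rewrite [X in _ = _ + X]big1 ?addr0 // => i ip.
  by apply: lcoefX_lt => //; lia.
have -> : (1 - f) * S p = 1 - f ^+ p.+1.
  by rewrite -opprB mulNr -subrX1 opprB.
by rewrite lcoefD lcoefN lcoefX_lt ?subr0 //; lia.
Qed.

Lemma laurent_inv f : f != 0 -> exists g, f * g = 1.
Proof.
move=> f0; have [M fM] := laurentP f.
have [p fp] : exists p : nat, f (M + p%:Z) != 0.
  apply: contrapT => /forallNP fp; case/eqP: f0; apply: laurent_ext => i.
  rewrite lcoef0; have [/fM//|Mi] := ltP i M.
  have [p ->] := int_offset Mi.
  exact/eqP/negPn/negP/fp.
case: (ex_minnP (ex_intro (fun p : nat => f (M + p%:Z) != 0) p fp)) => q fq qmin.
pose N := M + q%:Z; pose c := (f N)^-1.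
pose u := lmonom c (- N) * f.
have u1 j : j < 1 -> (1 - u) j = 0.
  move=> j1; rewrite lcoefD lcoefN lcoef1 lcoef_monomM opprK.
  have [->|j0] := eqVneq j 0; first by rewrite add0r mulVf ?subrr.
  rewrite sub0r; apply/eqP; rewrite oppr_eq0 mulf_eq0; apply/orP; right.
  have [/fM->//|Mj] := ltP (j + N) M.
  have [r jE] := int_offset Mj.
  rewrite jE; apply/negPn/negP => /qmin qr.
  by move/eqP: j0 jE; rewrite /N; lia.
have [g] := geom_inv u1; rewrite opprB addrC subrK /u => ug.
by exists (lmonom c (- N) * g); rewrite mulrCA mulrA.
Qed.

Definition linv f : laurent k :=
  if pselect (exists g, f * g = 1) is left fg then sval (cid fg) else 0.

Fact lmulVf f : f != 0 -> linv f * f = 1.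
Proof.
move=> /laurent_inv fg; rewrite /linv; case: pselect => // fg'.
by rewrite mulrC; exact: svalP (cid fg').
Qed.

Fact linv0 : linv 0 = 0.
Proof.
rewrite /linv; case: pselect => // fg; exfalso; case: fg => g.
by rewrite mul0r => /esym/eqP; rewrite oner_eq0.
Qed.

HB.instance Definition _ :=
  GRing.ComNzRing_isField.Build (laurent k) lmulVf linv0.

End LaurentField.

Definition laurentX (k : fieldType) : laurent k := lmonom 1 1.
Arguments laurentX {k}.

(* k[[z]] and k((z^2)) inside k((z)) *)
Definition laurent_int (k : fieldType) : {pred laurent k} :=
  fun f => `[< forall i : int, i < 0 -> f i = 0 >].
Definition laurent_even (k : fieldType) : {pred laurent k} :=
  fun f => `[< forall i : int, ~~ (2 %| i)%Z -> f i = 0 >].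
Arguments laurent_int {k}.
Arguments laurent_even {k}.

(* GL_n(S), as a subset of GL_n(F), for a subring S of the field F *)
Definition GLn_over (F : fieldType) (n : nat) (S : {pred F}) (g : 'M[F]_n) : bool :=
  [&& g \in unitmx, g \is a mxOver S & invmx g \is a mxOver S].

(* rho(g) = lam and sigma(g) = a are stated as relations: that every g in
   GL_n(k((z))) has exactly one rho and one sigma is a theorem, not needed to
   say what they are. *)
Definition dominant_coweight (k : fieldType) (n : nat)
    (g : 'M[laurent k]_n) (lam : seq int) : Prop :=
  [/\ size lam = n, sorted (fun x y : int => y <= x) lam &
   exists u v : 'M[laurent k]_n,
     [/\ GLn_over laurent_int u, GLn_over laurent_int v &
      g = u *m diag_mx (\row_(i < n) laurentX ^ nth 0 lam i) *m v]].

(* The blocks (1), (z) and (1 z; 0 z^i), i > 1. *)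
Inductive symblock :=
  | SymOne
  | SymZ
  | SymPair (i : nat) of (1 < i)%N.

Definition symblock_size (b : symblock) : nat :=
  if b is SymPair _ _ then 2 else 1.

Definition symblock_mx (k : fieldType) (b : symblock) :
    'M[laurent k]_(symblock_size b) :=
  match b with
  | SymOne => 1%:M
  | SymZ => laurentX%:M
  | SymPair i _ =>
      block_mx (1%:M : 'M_1) (laurentX%:M : 'M_1)
               (0 : 'M_1)    ((laurentX ^+ i)%:M : 'M_1)
  end.
Arguments symblock_mx k b : clear implicits.

Definition symblock_weight (b : symblock) : seq nat :=
  match b with
  | SymOne => [:: 0%N]
  | SymZ => [:: 1%N]
  | SymPair i _ => [:: i; 0%N]
  end.

Definition symmetric_coweight (k : fieldType) (n : nat)
    (g : 'M[laurent k]_n) (a : seq nat) : Prop :=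
  exists (m : nat) (s : 'I_m -> symblock)
      (e : (\sum_(j < m) symblock_size (s j))%N = n) (u h : 'M[laurent k]_n),
    [/\ GLn_over laurent_int u, GLn_over laurent_even h,
        g = u *m castmx (e, e) (\mxdiag_(j < m) symblock_mx k (s j)) *m h &
        a = sort geq (flatten [seq symblock_weight (s j) | j <- enum 'I_m])].

(* Main.v *)
(* Matrices act on row vectors, so g enters through its transpose G = g^T.  Two
   families of invariants of g recover its symmetric coweight a.

   Write x' for the image of x under z |-> -z.  For m > 0, the number of a_j > m
   is the largest dimension of a k((z))-subspace of k((z))^n on which
   val(x G) >= val(x' G) + m: on a block (1 z; 0 z^i) the line spanned by (-z, 1)
   gains i - 1, because 2 is invertible, and a complementary subspace of the
   right dimension gains strictly less than m everywhere.

   The number of a_j >= 1, resp. of a_j = 0, is the dimension of the space of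
   leading coefficients of the vectors x G with x in k((z^2))^n and
   val(x G) >= 1, resp. >= 0.

   If rho(A) = (l, 0, ..., 0), then A is integral, is an isometry on a hyperplane,
   and has corank at most 1 modulo z, so passing to a hyperplane shows that each
   of these dimensions changes by at most 1 when B is replaced by AB. *)
Require Import Defs.
From HB Require Import structures.
From mathcomp Require Import all_boot all_order all_algebra.
From mathcomp Require Import boolp zify.

Set Implicit Arguments.
Unset Strict Implicit.
Unset Printing Implicit Defensive.

Import Order.TTheory GRing.Theory Num.Theory.
Local Open Scope ring_scope.

(** * Lower bounds on valuations of Laurent series *)

(** A predicate rather than a valuation function, so that the zero series, of infinite valuation,
    needs no separate case. *)
Definition vge (k : fieldType) (t : int) (f : laurent k) : Prop :=
  forall i : int, i < t -> f i = 0.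

Definition mxvge (k : fieldType) (m n : nat) (t : int) (A : 'M[laurent k]_(m, n)) :=
  forall i j, vge t (A i j).

Section Valuation.
Variable k : fieldType.
Implicit Types f g : laurent k.

Lemma vge0 t : vge t (0 : laurent k).
Proof. by move=> i _; rewrite lcoef0. Qed.

Lemma vge1 : vge 0 (1 : laurent k).
Proof. by move=> i i0; rewrite lcoef1; case: eqP => // ?; lia. Qed.

Lemma vge_le t s f : s <= t -> vge t f -> vge s f.
Proof. by move=> st ft i si; apply: ft; lia. Qed.

Lemma vgeD t f g : vge t f -> vge t g -> vge t (f + g).
Proof. by move=> ft gt i it; rewrite lcoefD ft ?gt ?addr0. Qed.

Lemma vgeN t f : vge t f -> vge t (- f).
Proof. by move=> ft i it; rewrite lcoefN ft ?oppr0. Qed.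

Lemma vgeM t s f g : vge t f -> vge s g -> vge (t + s) (f * g).
Proof. by move=> ft gs i its; apply: (lcoefM_lt ft gs). Qed.

Lemma lcoefM_lead t s f g :
  vge t f -> vge s g -> (f * g) (t + s) = f t * g s.
Proof.
move=> ft gs; rewrite -[in LHS](addr0 (t + s)) -[0]/(0%N%:Z) (lcoefM 0 ft gs).
by rewrite big_ord1 /= !addr0.
Qed.

Lemma laurentXnE i : laurentX ^+ i = lmonom 1 i%:Z :> laurent k.
Proof.
elim: i => [|i IHi]; first by rewrite expr0.
by rewrite exprS IHi lmonomM mul1r; congr lmonom; lia.
Qed.

Lemma lcoefXnM i f (j : int) : (laurentX ^+ i * f) j = f (j - i%:Z).
Proof. by rewrite laurentXnE lcoef_monomM mul1r. Qed.

Lemma lcoefXM f (j : int) : (laurentX * f) j = f (j - 1).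
Proof. by rewrite lcoef_monomM mul1r. Qed.

Lemma vgeXnM t i f : vge (t + i%:Z) (laurentX ^+ i * f) <-> vge t f.
Proof.
split=> ft j jt; last by rewrite lcoefXnM ft //; lia.
by have := ft (j + i%:Z); rewrite lcoefXnM addrK; apply; lia.
Qed.

Lemma vgeXM t f : vge (t + 1) (laurentX * f) <-> vge t f.
Proof. by rewrite -(vgeXnM t 1). Qed.

Lemma vge_unbounded f : (forall j : nat, vge j%:Z f) -> f = 0.
Proof.
move=> fP; apply: laurent_ext => i; rewrite lcoef0.
by apply: (fP (absz i).+1); lia.
Qed.

(* The automorphism z |-> -z, whose fixed field is k((z^2)) if 2 != 0 in k. *)
Fact lconj_subproof f :
  exists N : int, forall i, i < N -> (if (2 %| i)%Z then f i else - f i) = 0.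
Proof.
have [N fN] := laurentP f; exists N => i iN.
by rewrite fN // oppr0 if_same.
Qed.
Definition lconj f : laurent k := Laurent (lconj_subproof f).

Lemma lconjE f i : lconj f i = if (2 %| i)%Z then f i else - f i.
Proof. by []. Qed.

Lemma lconj_vge t f : vge t (lconj f) <-> vge t f.
Proof.
split=> ft i it; last by rewrite lconjE ft // oppr0 if_same.
by have := ft i it; rewrite lconjE; case: ifP => // _ /eqP; rewrite oppr_eq0 => /eqP.
Qed.

Fact lconj_is_zmod_morphism : zmod_morphism lconj.
Proof.
move=> f g; apply: laurent_ext => i.
by rewrite !(lcoefD, lcoefN, lconjE); case: ifP => // _; rewrite opprD.
Qed.

Fact lconj_is_monoid_morphism : monoid_morphism lconj.
Proof.
split.
  apply: laurent_ext => i; rewrite lconjE lcoef1; case: eqP => [->//|_].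
  by rewrite oppr0 if_same.
move=> f g; apply: laurent_ext => i; rewrite lconjE.
have [[N fN] [M gM]] := (laurentP f, laurentP g).
have [fN' gM'] : vge N (lconj f) /\ vge M (lconj g) by split; apply/lconj_vge.
have [iNM|NMi] := ltP i (N + M).
  by rewrite (lcoefM_lt fN gM iNM) (lcoefM_lt fN' gM' iNM) oppr0 if_same.
have [p ->] := int_offset NMi.
rewrite (lcoefM p fN gM) (lcoefM p fN' gM') -sumrN.
rewrite (_ : (if _ then _ else _) = \sum_(j < p.+1) (if (2 %| N + M + p%:Z)%Z
    then f (N + j%:Z) * g (M + (p - j)%N%:Z)
    else - (f (N + j%:Z) * g (M + (p - j)%N%:Z)))); last by case: ifP.
apply: eq_bigr => j _; have jp := ltn_ord j; rewrite !lconjE.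
(* The degree of a product term is the sum of the degrees of its factors, so the signs multiply. *)
have -> : (2 %| N + M + p%:Z)%Z = ((2 %| N + j%:Z)%Z == (2 %| M + (p - j)%N%:Z)%Z).
  by lia.
by case: (2 %| N + _)%Z; case: (2 %| M + _)%Z; rewrite /= ?mulrN ?mulNr ?opprK.
Qed.

HB.instance Definition _ :=
  GRing.isZmodMorphism.Build (laurent k) (laurent k) lconj lconj_is_zmod_morphism.
HB.instance Definition _ :=
  GRing.isMonoidMorphism.Build (laurent k) (laurent k) lconj lconj_is_monoid_morphism.

Lemma lconjK f : lconj (lconj f) = f.
Proof. by apply: laurent_ext => i; rewrite !lconjE; case: (2 %| i)%Z; rewrite ?opprK. Qed.

Lemma lconjX : lconj laurentX = - laurentX.
Proof.
apply: laurent_ext => i; rewrite lconjE lcoefN /=.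
by case: eqP => [->//|_]; rewrite oppr0 if_same.
Qed.

Lemma lconj_even f : f \in laurent_even -> lconj f = f.
Proof.
move=> /asboolP fP; apply: laurent_ext => i; rewrite lconjE.
by case: ifPn => // /fP ->; rewrite oppr0.
Qed.

(** An odd coefficient of a fixed series equals its own opposite, and 2 is invertible. *)
Lemma lconj_fixed f (i : int) :
  2%:R != 0 :> k -> lconj f = f -> ~~ (2 %| i)%Z -> f i = 0.
Proof.
move=> k2 /(congr1 (fun g : laurent k => g i)); rewrite lconjE.
case: ifP => // _ /eqP; rewrite eq_sym -subr_eq0 opprK -mulr2n -mulr_natr.
by rewrite mulf_eq0 (negbTE k2) orbF => /eqP.
Qed.

End Valuation.

(** * Valuations and leading coefficients of matrices *)

Section MatrixValuation.
Variable k : fieldType.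

Lemma mxvge_le m n t s (A : 'M[laurent k]_(m, n)) : s <= t -> mxvge t A -> mxvge s A.
Proof. by move=> st At i j; apply: vge_le st _. Qed.

Lemma mxvge0 m n t : mxvge t (0 : 'M[laurent k]_(m, n)).
Proof. by move=> i j; rewrite mxE; apply: vge0. Qed.

Lemma vge_sum (I : Type) (r : seq I) (P : pred I) (F : I -> laurent k) t :
  (forall i, P i -> vge t (F i)) -> vge t (\sum_(i <- r | P i) F i).
Proof.
move=> Ft; elim/big_rec: _ => [|i x Pi xt]; first exact: vge0.
by apply: vgeD => //; apply: Ft.
Qed.

Lemma mxvgeM m n p t s (A : 'M[laurent k]_(m, n)) (B : 'M_(n, p)) :
  mxvge t A -> mxvge s B -> mxvge (t + s) (A *m B).
Proof. by move=> At Bs i j; rewrite mxE; apply: vge_sum => l _; apply: vgeM. Qed.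

Lemma coefmxM m n p t s (A : 'M[laurent k]_(m, n)) (B : 'M_(n, p)) :
  mxvge t A -> mxvge s B ->
  map_mx (fun f : laurent k => f (t + s)) (A *m B) =
  map_mx (fun f : laurent k => f t) A *m map_mx (fun f : laurent k => f s) B.
Proof.
move=> At Bs; apply/matrixP => i j; rewrite !mxE lcoef_sum.
by apply: eq_bigr => l _; rewrite !mxE lcoefM_lead.
Qed.

(** Elements of GL_n(k[[z]]) act as isometries: both [U] and its inverse are integral. *)
Lemma mxvge_unitr m n t (A : 'M[laurent k]_(m, n)) (U : 'M_n) :
    U \in unitmx -> mxvge 0 U -> mxvge 0 (invmx U) ->
  mxvge t (A *m U) <-> mxvge t A.
Proof.
move=> uU U0 V0; split=> At; last by rewrite -[t]addr0; apply: mxvgeM.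
by rewrite -(mulmxK uU A) -[t]addr0; apply: mxvgeM.
Qed.

Lemma mxvge_conj m n t (A : 'M[laurent k]_(m, n)) :
  mxvge t (map_mx (@lconj k) A) <-> mxvge t A.
Proof.
by split=> At i j; have := At i j; rewrite mxE lconj_vge.
Qed.

Lemma mxvge_exists m n (A : 'M[laurent k]_(m, n)) : exists t, mxvge t A.
Proof.
have /choice [N NP] : forall ij : 'I_m * 'I_n, exists t : nat, vge (- t%:Z) (A ij.1 ij.2).
  move=> ij; have [N NP] := laurentP (A ij.1 ij.2).
  by exists (absz N) => i iN; apply: NP; lia.
exists (- (\max_ij N ij)%N%:Z) => i j; apply: vge_le (NP (i, j)).
by have := @leq_bigmax_cond _ xpredT N (i, j) isT; lia.
Qed.

Lemma mxvge_mxrow p (q_ : 'I_p -> nat) m t (B_ : forall j, 'M[laurent k]_(m, q_ j)) :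
  mxvge t (\mxrow_j B_ j) <-> forall j, mxvge t (B_ j).
Proof.
split=> Bt; last by move=> i l; rewrite mxE; apply: Bt.
by move=> j i l; rewrite -[B_ j](mxrowK B_) mxE; apply: Bt.
Qed.

End MatrixValuation.

Notation lconjmx := (map_mx (@lconj _)).
Notation coefmx t := (map_mx (fun f : laurent _ => f t)).

(** * Subspaces on which the valuation grows relative to the conjugate vector *)

Section TwistedExpansion.
Variable k : fieldType.

Lemma lconjmxM m n p (A : 'M[laurent k]_(m, n)) (B : 'M_(n, p)) :
  lconjmx (A *m B) = lconjmx A *m lconjmx B.
Proof. exact: map_mxM. Qed.

Lemma lconjmxE m n (A : 'M[laurent k]_(m, n)) i j : lconjmx A i j = lconj (A i j).
Proof. exact: mxE. Qed.

Lemma lconjmxK m n (A : 'M[laurent k]_(m, n)) : lconjmx (lconjmx A) = A.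
Proof. by apply/matrixP => i j; rewrite !lconjmxE lconjK. Qed.

(* val (x G) >= val (x' G) + m on the row space of W. *)
Definition expands (n : nat) (m : int) (G W : 'M[laurent k]_n) : Prop :=
  forall t (x : 'rV_n), (x <= W)%MS ->
    mxvge t (lconjmx x *m G) -> mxvge (t + m) (x *m G).

(* val (x G) < val (x' G) + m on the nonzero vectors of the row space of W. *)
Definition expands_less (n : nat) (m : int) (G W : 'M[laurent k]_n) : Prop :=
  forall t (x : 'rV_n), (x <= W)%MS ->
    mxvge (t + m) (x *m G) -> mxvge (t + 1) (lconjmx x *m G).

(** The two row spaces meet only in 0, so their dimensions add up to at most [n]. *)
Lemma expands_rank n m (G W N : 'M[laurent k]_n) :
    G \in unitmx -> expands m G W -> expands_less m G N ->
  (\rank W + \rank N <= n)%N.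
Proof.
move=> uG expW lessN; rewrite -mxrank_disjoint_sum ?rank_leq_col //.
apply/eqP/rowV0P => x; rewrite sub_capmx => /andP[xW xN].
have [t0 xt0] := mxvge_exists (lconjmx x *m G).
(* Expansion turns a bound on x' G into one on x G, and the strict upper bound on the gain returns a
   bound on x' G larger by 1. Iterating forces x' G = 0. *)
have xt (j : nat) : mxvge (t0 + j%:Z) (lconjmx x *m G).
  elim: j => [|j IHj]; first by rewrite addr0.
  have -> : t0 + j.+1%:Z = t0 + j%:Z + 1 by lia.
  exact: lessN xN (expW _ _ xW IHj).
have xG0 : lconjmx x *m G = 0.
  apply/matrixP => i l; rewrite [RHS]mxE; apply: vge_unbounded => j.
  by apply: vge_le (xt (absz (j%:Z - t0)) i l); lia.
have : lconjmx x = 0 by rewrite -(mulmxK uG (lconjmx x)) xG0 mul0mx.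
move=> /matrixP x0; apply/matrixP => i j; have := x0 i j.
by rewrite !mxE => /eqP; rewrite fmorph_eq0 => /eqP.
Qed.

(* The substitution x H = y of row vectors commutes with z |-> -z since H has
   coefficients in k((z^2)). *)
Lemma conj_change_basis n (W G H V U : 'M[laurent k]_n) (x : 'rV[laurent k]_n) :
    V *m H = 1%:M -> lconjmx H = H ->
  (x *m (W *m V) *m (H *m G *m U) = x *m W *m G *m U) *
  (lconjmx (x *m (W *m V)) *m (H *m G *m U) = lconjmx (x *m W) *m G *m U).
Proof.
move=> VH cH; split; first by rewrite !mulmxA -(mulmxA (x *m W)) VH mulmx1.
have -> : x *m W = x *m (W *m V) *m H by rewrite -!mulmxA VH mulmx1.
by rewrite (lconjmxM _ H) cH !mulmxA.
Qed.

(** Since [H] commutes with conjugation and [U] is an isometry, the subspace is merely transported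
    by [V], the inverse of [H]. *)
Lemma expands_mul n m (G W H V U : 'M[laurent k]_n) :
    V *m H = 1%:M -> lconjmx H = H ->
    U \in unitmx -> mxvge 0 U -> mxvge 0 (invmx U) ->
  expands m G W -> expands m (H *m G *m U) (W *m V).
Proof.
move=> VH cH uU U0 V0 expW t x /submxP[D ->].
have [-> ->] := conj_change_basis W G U D VH cH.
move=> /(mxvge_unitr _ _ uU U0 V0) xt; apply/(mxvge_unitr _ _ uU U0 V0).
exact: expW (submxMl _ _) xt.
Qed.

Lemma expands_less_mul n m (G W H V U : 'M[laurent k]_n) :
    V *m H = 1%:M -> lconjmx H = H ->
    U \in unitmx -> mxvge 0 U -> mxvge 0 (invmx U) ->
  expands_less m G W -> expands_less m (H *m G *m U) (W *m V).
Proof.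
move=> VH cH uU U0 V0 lessW t x /submxP[D ->].
have [-> ->] := conj_change_basis W G U D VH cH.
move=> /(mxvge_unitr _ _ uU U0 V0) xt; apply/(mxvge_unitr _ _ uU U0 V0).
exact: lessW (submxMl _ _) xt.
Qed.

Lemma map_mxrow (R S : Type) (f : R -> S) p (q_ : 'I_p -> nat) m
    (B_ : forall j, 'M[R]_(m, q_ j)) :
  map_mx f (\mxrow_j B_ j) = \mxrow_j map_mx f (B_ j).
Proof. by apply/matrixP => i j; rewrite !mxE. Qed.

Lemma submx_mxdiagP (F : fieldType) p (q_ : 'I_p -> nat) m
    (A : 'M[F]_(m, \sum_j q_ j)) (W_ : forall j, 'M[F]_(q_ j)) :
  (A <= \mxdiag_j W_ j)%MS ->
  exists2 A_, A = \mxrow_j A_ j & forall j, (A_ j <= W_ j)%MS.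
Proof.
case/submxP => D ->; exists (fun j => submxrow D j *m W_ j) => [|j].
  by rewrite -{1}(submxrowK D) mul_mxrow_mxdiag.
exact: submxMl.
Qed.

Lemma expands_mxdiag p (q_ : 'I_p -> nat) m (G_ W_ : forall j, 'M[laurent k]_(q_ j)) :
  (forall j, expands m (G_ j) (W_ j)) ->
  expands m (\mxdiag_j G_ j) (\mxdiag_j W_ j).
Proof.
move=> expW t x /submx_mxdiagP[x_ -> xW].
rewrite map_mxrow !mul_mxrow_mxdiag !mxvge_mxrow => xt j.
exact: expW (xW j) (xt j).
Qed.

Lemma expands_less_mxdiag p (q_ : 'I_p -> nat) m
    (G_ W_ : forall j, 'M[laurent k]_(q_ j)) :
  (forall j, expands_less m (G_ j) (W_ j)) ->
  expands_less m (\mxdiag_j G_ j) (\mxdiag_j W_ j).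
Proof.
move=> lessW t x /submx_mxdiagP[x_ -> xW].
rewrite map_mxrow !mul_mxrow_mxdiag !mxvge_mxrow => xt j.
exact: lessW (xW j) (xt j).
Qed.

End TwistedExpansion.

(** * Expansion on a single block *)

Section Blocks.
Variable k : fieldType.
Implicit Type b : symblock.

Lemma mxvge2 r t (A : 'M[laurent k]_(r, 2)) :
  mxvge t A <-> forall i, vge t (A i 0) /\ vge t (A i 1).
Proof.
split=> At i; first by split; apply: At.
move=> j; have [At0 At1] := At i.
have [->|->] // : j = 0 \/ j = 1.
by case: j => -[|[|]] // ?; [left|right]; apply/val_inj.
Qed.

Lemma mulmx2E (R : pzSemiRingType) m n (A : 'M[R]_(m, 2)) (B : 'M[R]_(2, n)) p q :
  (A *m B) p q = A p 0 * B 0 q + A p 1 * B 1 q.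
Proof.
rewrite mxE big_ord_recl big_ord1 (_ : ord0 = 0) 1?(_ : lift _ _ = 1) //.
exact/val_inj.
Qed.

Lemma mul_symblock_pair r i (i1 : (1 < i)%N) (A : 'M[laurent k]_(r, 2)) p :
  ((A *m (symblock_mx k (SymPair i1))^T) p 0 = A p 0 + laurentX * A p 1) *
  ((A *m (symblock_mx k (SymPair i1))^T) p 1 = laurentX ^+ i * A p 1).
Proof.
have e0 : 0 = @lshift 1 1 0 :> 'I_2 by apply/val_inj.
have e1 : 1 = @rshift 1 1 0 :> 'I_2 by apply/val_inj.
rewrite /=; set T := block_mx _ _ _ _.
have T00 : T 0 0 = 1 by rewrite e0 block_mxEul mxE.
have T01 : T 0 1 = laurentX by rewrite e0 e1 block_mxEur mxE.
have T10 : T 1 0 = 0 by rewrite e0 e1 block_mxEdl mxE.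
have T11 : T 1 1 = laurentX ^+ i by rewrite e1 block_mxEdr mxE.
have TE q : (A *m T^T) p q = A p 0 * T q 0 + A p 1 * T q 1.
  by rewrite mulmx2E !(mxE trmx_key).
by split; rewrite TE ?T00 ?T01 ?T10 ?T11 ?mulr1 ?mulr0 ?add0r mulrC.
Qed.

(** On a pair block (-z, 1) goes to (0, z^i), while its conjugate (z, 1) goes to (2z, z^i): the gain
    is i - 1. The generated space is a square matrix, as needed for assembling a block diagonal
    one. *)
Definition expanding_space (m : nat) b : 'M[laurent k]_(symblock_size b) :=
  match b with
  | SymPair i _ => if (m < i)%N then <<row_mx (- laurentX)%:M 1%:M : 'rV_2>>%MS else 0
  | _ => 0
  end.

(** A space of the complementary dimension: the line of (1, 0) is fixed by the block and gains
    nothing. *)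
Definition less_expanding_space (m : nat) b : 'M[laurent k]_(symblock_size b) :=
  match b with
  | SymPair i _ => if (m < i)%N then <<row_mx 1%:M 0 : 'rV_2>>%MS else 1%:M
  | _ => 1%:M
  end.

End Blocks.

Section BlockExpansion.
Variable k : fieldType.
Implicit Type b : symblock.

Lemma vgeDr t (f g : laurent k) : vge t g -> vge t (f + g) <-> vge t f.
Proof.
move=> gt; split=> ft; last exact: vgeD.
by rewrite -(addrK g f); apply: vgeD => //; apply: vgeN.
Qed.

Lemma symblock_expands (m : nat) b :
  2%:R != 0 :> k ->
  expands m%:Z (symblock_mx k b)^T (expanding_space k m b).
Proof.
move=> k2; case: b => [||i i1] t x.
- by rewrite submx0 => /eqP-> _; rewrite mul0mx; apply: mxvge0.
- by rewrite submx0 => /eqP-> _; rewrite mul0mx; apply: mxvge0.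
rewrite [expanding_space _ _ _]/=; case: ifPn => mi; last first.
  by rewrite submx0 => /eqP-> _; rewrite mul0mx; apply: mxvge0.
change 'rV[laurent k]_2 in x; rewrite genmxE => /sub_rVP[c].
have e0 : 0 = @lshift 1 1 0 :> 'I_2 by apply/val_inj.
have e1 : 1 = @rshift 1 1 0 :> 'I_2 by apply/val_inj.
set r := row_mx _ _ => xE.
have r0 : r 0 0 = - laurentX by rewrite e0 row_mxEl mxE mulr1n.
have r1 : r 0 1 = 1 by rewrite e1 row_mxEr mxE.
have x0 : x 0 0 = - (laurentX * c) by rewrite xE mxE r0 mulrN mulrC.
have x1 : x 0 1 = c by rewrite xE mxE r1 mulr1.
move=> {r r0 r1 xE} /mxvge2 /(_ 0).
rewrite !(mul_symblock_pair i1) !lconjmxE x0 x1.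
rewrite rmorphN rmorphM /= lconjX mulNr opprK => -[ct _].
(* The first coordinate of the conjugate image is 2 z c', where c' is the conjugate of [c], so
   dividing by 2 z bounds [c]. *)
have {}ct : vge (t - 1) c.
  apply/lconj_vge => j jt; have := ct (j + 1).
  rewrite lcoefD lcoefXM addrK -mulr2n -mulr_natr => cj.
  have /eqP : lconj c j * 2%:R = 0 by apply: cj; lia.
  by rewrite mulf_eq0 (negbTE k2) orbF => /eqP.
apply/mxvge2 => p; rewrite [p]ord1 !(mul_symblock_pair i1) x0 x1; split.
  by rewrite addNr; apply: vge0.
by apply: vge_le (proj2 (vgeXnM _ _ _) ct); lia.
Qed.

Lemma symblock_expands_less (m : nat) b :
  (0 < m)%N -> expands_less m%:Z (symblock_mx k b)^T (less_expanding_space k m b).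
Proof.
move=> m0; case: b => [||i i1] t x.
- move=> _; rewrite /= trmx1 !mulmx1 => xt; apply/mxvge_conj.
  by apply: mxvge_le xt; lia.
- move=> _; rewrite /= tr_scalar_mx !mul_mx_scalar => xt p q.
  have := xt p q; rewrite !mxE => {}xt.
  apply/vgeXM/lconj_vge/vgeXM; apply: vge_le xt; lia.
rewrite [less_expanding_space _ _ _]/=; case: ifPn => mi.
  change 'rV[laurent k]_2 in x; rewrite genmxE => /sub_rVP[c].
  have e0 : 0 = @lshift 1 1 0 :> 'I_2 by apply/val_inj.
  have e1 : 1 = @rshift 1 1 0 :> 'I_2 by apply/val_inj.
  set r := row_mx _ _ => xE.
  have r0 : r 0 0 = 1 by rewrite e0 row_mxEl mxE.
  have r1 : r 0 1 = 0 by rewrite e1 row_mxEr mxE.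
  have x0 : x 0 0 = c by rewrite xE mxE r0 mulr1.
  have x1 : x 0 1 = 0 by rewrite xE mxE r1 mulr0.
  move=> {r r0 r1 xE} /mxvge2 /(_ 0).
  rewrite !(mul_symblock_pair i1) x0 x1 mulr0 addr0 => -[ct _].
  apply/mxvge2 => p; rewrite [p]ord1 !(mul_symblock_pair i1) !lconjmxE x0 x1.
  rewrite rmorph0 !mulr0 addr0; split; last exact: vge0.
  by apply/lconj_vge; apply: vge_le ct; lia.
move=> _ /mxvge2 xt; apply/mxvge2 => p; have := xt p.
rewrite !(mul_symblock_pair i1) !lconjmxE.
move: (x p 0) (x p 1) => f g [ft gt].
(* Here i <= m. The second coordinate z^i g bounds g, hence z g; then the first coordinate f + z g
   bounds f. *)
have {}gt : vge t g by apply/(vgeXnM _ i); apply: vge_le gt; lia.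
have gt1 : vge (t + 1) (laurentX * g) by apply/vgeXM.
split.
  apply: vgeD; last by apply/vgeXM/lconj_vge.
  by apply/lconj_vge/(vgeDr _ gt1); apply: vge_le ft; lia.
have : vge (t + i%:Z) (laurentX ^+ i * lconj g) by apply/vgeXnM/lconj_vge.
by apply: vge_le; lia.
Qed.

(** With m positive, the weight 1 of the block (z) stays below the threshold m + 1, so only pairs
    with i > m count. *)
Lemma rank_expanding_space (m : nat) b : (0 < m)%N ->
  \rank (expanding_space k m b) = count (leq m.+1) (symblock_weight b).
Proof.
case: m => // m _; case: b => [||i i1] /=; rewrite ?mxrank0 //.
case: ifP; rewrite ?mxrank0 // mxrank_gen rank_rV => _.
case: eqP => // /matrixP/(_ 0 (@rshift 1 1 0)).
by rewrite (@row_mxEr _ 1 1 1) !mxE => /eqP; rewrite oner_eq0.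
Qed.

Lemma rank_less_expanding_space (m : nat) b : (0 < m)%N ->
  \rank (less_expanding_space k m b) =
  (symblock_size b - count (leq m.+1) (symblock_weight b))%N.
Proof.
case: m => // m _; case: b => [||i i1] /=; rewrite ?mxrank1 //.
case: ifP; rewrite ?mxrank1 // mxrank_gen rank_rV => _.
case: eqP => // /matrixP/(_ 0 (@lshift 1 1 0)).
by rewrite (@row_mxEl _ 1 1 1) !mxE => /eqP; rewrite oner_eq0.
Qed.

End BlockExpansion.

(** * Leading coefficients of vectors over k((z^2)) *)

Section EvenReduction.
Variable k : fieldType.
Implicit Type b : symblock.

Lemma coefmx0_1 n : coefmx 0 (1%:M : 'M[laurent k]_n) = 1%:M.
Proof. by apply/matrixP => i j; rewrite !mxE; case: eqP => _; rewrite ?lcoef1 ?lcoef0. Qed.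

Lemma coefmx_0 m n t : coefmx t (0 : 'M[laurent k]_(m, n)) = 0.
Proof. by apply/matrixP => i j; rewrite !mxE lcoef0. Qed.

(** Reduction modulo z is multiplicative on integral matrices. *)
Lemma coefmx0_unit n (U V : 'M[laurent k]_n) :
  mxvge 0 U -> mxvge 0 V -> U *m V = 1%:M -> coefmx 0 U \in unitmx.
Proof.
move=> U0 V0 UV; have := coefmxM U0 V0; rewrite addr0 UV coefmx0_1 => UV0.
by have [] := mulmx1_unit (esym UV0).
Qed.

Lemma rank_coefmx_unitr m n t (A : 'M[laurent k]_(m, n)) (U : 'M_n) :
    U \in unitmx -> mxvge 0 U -> mxvge 0 (invmx U) -> mxvge t A ->
  \rank (coefmx t (A *m U)) = \rank (coefmx t A).
Proof.
move=> uU U0 V0 At; have := coefmxM At U0; rewrite addr0 => ->.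
rewrite mxrankMfree // row_free_unit.
exact: coefmx0_unit U0 V0 (mulmxV uU).
Qed.

Lemma rank_mxrow (F : fieldType) p (q_ : 'I_p -> nat) m (A_ : forall j, 'M[F]_(m, q_ j)) :
  (\rank (\mxrow_j A_ j) <= \sum_j \rank (A_ j))%N.
Proof.
rewrite -mxrank_tr tr_mxrow eqmx_col.
apply: leq_trans (mxrank_sum_leqif _).1 _.
by apply: leq_sum => j _; rewrite /= mxrank_gen mxrank_tr.
Qed.

(** The boolean [e] stands for the exponent 0 or 1. Over k((z^2)) the block (1) yields only even
    exponents and (z) only odd ones, while a pair yields one dimension for each parity. *)
Definition even_rank (e : bool) b : nat :=
  match b with SymOne => ~~ e | SymZ => e | SymPair _ _ => 1 end.

(** Vectors attaining [even_rank]. In a pair, (1, 0) goes to (1, 0) and (0, 1) to (z, z^i); as i >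
    1, both have leading coefficient (1, 0). *)
Definition even_space (e : bool) b : 'M[laurent k]_(symblock_size b) :=
  match b with
  | SymOne => if e then 0 else 1%:M
  | SymZ => if e then 1%:M else 0
  | SymPair _ _ => delta_mx (0 : 'I_2) (if e then 1 else 0 : 'I_2)
  end.

Lemma conj_even_space e b : lconjmx (even_space e b) = even_space e b.
Proof.
case: b => [||i i1] /=; last first.
  by apply/matrixP => p q; rewrite !mxE rmorph_nat.
all: by case: e; rewrite ?map_mx1 ?map_mx0.
Qed.

Lemma symblock_even_space (e : bool) b :
  mxvge e%:Z (even_space e b *m (symblock_mx k b)^T) /\
  \rank (coefmx e%:Z (even_space e b *m (symblock_mx k b)^T)) = even_rank e b.
Proof.
case: b => [||i i1].
- rewrite /= trmx1 mulmx1; case: e => /=.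
    by rewrite coefmx_0 mxrank0; split=> //; exact: mxvge0.
  split; last by rewrite coefmx0_1 mxrank1.
  by move=> p q; rewrite !ord1 mxE; apply: vge1.
- rewrite /= tr_scalar_mx; case: e => /=; last first.
    by rewrite mul0mx coefmx_0 mxrank0; split=> //; exact: mxvge0.
  rewrite mul1mx; split.
    by move=> p q; rewrite !ord1 mxE -[laurentX]mulr1; apply/(vgeXM 0)/vge1.
  rewrite (_ : coefmx _ _ = 1%:M) ?mxrank1 //.
  by apply/matrixP => p q; rewrite !ord1 !mxE.
pose W : 'M[laurent k]_2 := even_space e (SymPair i1); rewrite -[even_space _ _]/W.
have W0 p : W p 0 = ((p == 0) && ~~ e)%:R by rewrite /W /= mxE; case: (e).
have W1 p : W p 1 = ((p == 0) && e)%:R by rewrite /W /= mxE; case: (e).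
have X1 : vge 1 (laurentX : laurent k).
  by rewrite -[laurentX]mulr1; apply/(vgeXM 0)/vge1.
have Xi : vge 2 (laurentX ^+ i : laurent k).
  by rewrite -[_ ^+ _]mulr1; apply: vge_le (proj2 (vgeXnM 0 _ _) (@vge1 k)); lia.
split.
  apply/mxvge2 => p; rewrite !(mul_symblock_pair i1) W0 W1.
  case: (p == 0); case: (e); rewrite /= ?mulr0 ?mulr1 ?add0r ?addr0; split;
    by [exact: vge0 | exact: vge1 | | exact: vge_le Xi].
rewrite (_ : coefmx _ _ = delta_mx (0 : 'I_2) (0 : 'I_2)) ?mxrank_delta //.
apply/matrixP => p q; rewrite mxE.
have [->|->] : q = 0 \/ q = 1.
- by case: q => -[|[|]] // ?; [left|right]; apply/val_inj.
- rewrite (mul_symblock_pair i1) W0 W1 [RHS]mxE andbT.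
  case: (p == 0); case: (e); rewrite ?mulr0 ?mulr1 ?add0r ?addr0 ?lcoef0 ?lcoef1 //.
rewrite (mul_symblock_pair i1) W1 [RHS]mxE andbF.
case: (_ && _); rewrite ?mulr0 ?lcoef0 // mulr1.
by apply: Xi; case: (e).
Qed.

Lemma even_rank_le (e : bool) b r (W : 'M[laurent k]_(r, symblock_size b)) :
    2%:R != 0 :> k -> lconjmx W = W -> mxvge e%:Z (W *m (symblock_mx k b)^T) ->
  (\rank (coefmx e%:Z (W *m (symblock_mx k b)^T)) <= even_rank e b)%N.
Proof.
move=> k2 cW; have oddW p q j : ~~ (2 %| j)%Z -> W p q j = 0.
  by apply: lconj_fixed => //; rewrite -lconjmxE cW.
case: b W cW oddW => [||i i1] W cW oddW.
- rewrite /= trmx1 mulmx1; case: e => _; last exact: rank_leq_col.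
  rewrite leqn0 mxrank_eq0; apply/eqP/matrixP => p q.
  by rewrite !mxE oddW.
- rewrite /= tr_scalar_mx mul_mx_scalar; case: e => _; first exact: rank_leq_col.
  rewrite leqn0 mxrank_eq0; apply/eqP/matrixP => p q.
  by rewrite !mxE lcoefXM oddW.
change 'M[laurent k]_(r, 2) in W => /mxvge2 Wt.
pose Y : 'M[k]_(r, 2) := coefmx e%:Z (W *m (symblock_mx k (SymPair i1))^T).
rewrite -[coefmx _ _]/Y.
(* For a row (f, g) of [W] this is the coefficient of g in degree e - i. It vanishes if that degree
   is odd. Otherwise f has no term in the odd degree e - i + 1, so it is the coefficient of f + z g
   there, which is 0 because e - i + 1 < e. *)
have Y1 p : Y p 1 = 0.
  rewrite /Y mxE (mul_symblock_pair i1) lcoefXnM.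
  have [/(_ (e%:Z - i%:Z + 1)) + _] := Wt p.
  rewrite (mul_symblock_pair i1) lcoefD lcoefXM addrK.
  have [ev|/oddW -> //] := boolP (2 %| (e%:Z - i%:Z)%R)%Z.
  rewrite oddW ?add0r; last by lia.
  by apply; lia.
have -> : Y = col 0 Y *m row 0 (1%:M : 'M_2).
  clearbody Y; apply/matrixP => p q; rewrite [RHS]mxE big_ord1 !mxE.
  have [->|->] : q = 0 \/ q = 1.
  - by case: q => -[|[|]] // ?; [left|right]; apply/val_inj.
  - by rewrite mulr1.
  by rewrite mulr0 Y1.
by apply: leq_trans (mxrankM_maxl _ _) (rank_leq_col _).
Qed.

End EvenReduction.

(** * Both invariants computed from the symmetric coweight *)

Section SymmetricCoweight.
Variable k : fieldType.

Lemma mul_mxdiag_mxdiag (R : pzRingType) p (q_ : 'I_p -> nat)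
    (A_ B_ : forall j, 'M[R]_(q_ j)) :
  \mxdiag_j A_ j *m \mxdiag_j B_ j = \mxdiag_j (A_ j *m B_ j).
Proof.
rewrite [\mxdiag_j A_ j]/mxdiag mul_mxblock_mxdiag; apply: eq_mxblock => i j.
by case: eqVneq => [<-|_]; rewrite ?conform_mx_id ?mul0mx.
Qed.

Lemma map_mxdiag (R S : nmodType) (f : R -> S) p (q_ : 'I_p -> nat)
    (B_ : forall j, 'M[R]_(q_ j)) :
  f 0 = 0 -> map_mx f (\mxdiag_j B_ j) = \mxdiag_j map_mx f (B_ j).
Proof.
move=> f0; rewrite /mxdiag.
transitivity (\mxblock_(i, j)
    map_mx f (if i == j then conform_mx 0 (B_ i) else 0 : 'M_(q_ i, q_ j))).
  by apply/matrixP => i j; rewrite !mxE.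
apply: eq_mxblock => i j; case: eqVneq => [<-|_]; rewrite ?conform_mx_id //.
by apply/matrixP => ? ?; rewrite !mxE.
Qed.

Lemma mxvge_mxdiag p (q_ : 'I_p -> nat) t (B_ : forall j, 'M[laurent k]_(q_ j)) :
  (forall j, mxvge t (B_ j)) -> mxvge t (\mxdiag_j B_ j).
Proof.
move=> Bt; rewrite -[\mxdiag_j _]mul1mx -[1%:M]submxrowK mul_mxrow_mxdiag.
apply/mxvge_mxrow => j; rewrite -[t]add0r; apply: mxvgeM (Bt j) => i l.
by rewrite !mxE; case: eqP => _; [exact: vge1 | exact: vge0].
Qed.

Lemma GLn_over_intP n (u : 'M[laurent k]_n) :
  GLn_over laurent_int u -> [/\ u \in unitmx, mxvge 0 u & mxvge 0 (invmx u)].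
Proof.
case/and3P=> uu /mxOverP u0 /mxOverP v0; split=> //.
  by move=> i j; move: (u0 i j) => /asboolP.
by move=> i j; move: (v0 i j) => /asboolP.
Qed.

Lemma GLn_over_int_tr n (u : 'M[laurent k]_n) :
  GLn_over laurent_int u -> [/\ u^T \in unitmx, mxvge 0 u^T & mxvge 0 (invmx u^T)].
Proof.
case/GLn_over_intP=> uu u0 v0; rewrite unitmx_tr -trmx_inv; split=> //.
  by move=> i j; rewrite mxE.
by move=> i j; rewrite mxE.
Qed.

Lemma lconjmx_even n (h : 'M[laurent k]_n) :
  h \is a mxOver laurent_even -> lconjmx h^T = h^T.
Proof.
move=> /mxOverP hev; apply/matrixP => i j.
by rewrite lconjmxE mxE lconj_even.
Qed.

(** Transposition puts the k((z^2)) factor on the left and the integral one on the right. Counting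
    entries is insensitive to the sorting in the coweight. *)
Lemma symmetric_coweight_tr n (g : 'M[laurent k]_n) (a : seq nat) :
  symmetric_coweight g a ->
  exists m (s : 'I_m -> symblock) (e : (\sum_(j < m) symblock_size (s j))%N = n),
  exists H V U : 'M[laurent k]_n,
    [/\ [/\ V *m H = 1%:M, H *m V = 1%:M, lconjmx H = H & lconjmx V = V],
        [/\ U \in unitmx, mxvge 0 U & mxvge 0 (invmx U)],
        g^T = H *m castmx (e, e) (\mxdiag_(j < m) (symblock_mx k (s j))^T) *m U &
        forall p : pred nat, count p a = (\sum_(j < m) count p (symblock_weight (s j)))%N].
Proof.
case=> m [s] [e] [u] [h] [uint /and3P[uh hev vev] -> ->].
exists m, s, e, h^T, (invmx h)^T, u^T; split.
- split; [| | exact: lconjmx_even | exact: lconjmx_even].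
    by rewrite -trmx_mul mulmxV // trmx1.
  by rewrite -trmx_mul mulVmx // trmx1.
- exact: GLn_over_int_tr.
- by rewrite !trmx_mul trmx_cast tr_mxdiag mulmxA.
move=> p; rewrite (permP (permEl (perm_sort _ _))) count_flatten sumnE 2!big_map.
by rewrite big_enum.
Qed.

Lemma symmetric_coweight_expands n (g : 'M[laurent k]_n) (a : seq nat) (m : nat) :
    2%:R != 0 :> k -> (0 < m)%N -> symmetric_coweight g a ->
  exists W N : 'M[laurent k]_n,
    [/\ expands m%:Z g^T W, expands_less m%:Z g^T N,
        \rank W = count (leq m.+1) a & (\rank W + \rank N)%N = n].
Proof.
move=> k2 m0 /symmetric_coweight_tr[r] [s] [e] [H] [V] [U].
case=> [[VH HV cH _] [uU U0 V0] -> cnt].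
(* Identifying [n] with the total block size makes the cast an identity. *)
case: _ / e H V U VH HV cH uU U0 V0 => H V U VH HV cH uU U0 V0.
rewrite castmx_id.
exists ((\mxdiag_j expanding_space k m (s j)) *m V).
exists ((\mxdiag_j less_expanding_space k m (s j)) *m V).
have freeV : row_free V by rewrite row_free_unit; case: (mulmx1_unit VH).
rewrite !mxrankMfree // !rank_mxdiag; split.
- by apply: expands_mul => //; apply: expands_mxdiag => j; apply: symblock_expands.
- apply: expands_less_mul => //; apply: expands_less_mxdiag => j.
  exact: symblock_expands_less.
- by rewrite cnt; apply: eq_bigr => j _; rewrite rank_expanding_space.
rewrite -big_split; apply: eq_bigr => j _ /=.
rewrite rank_expanding_space // rank_less_expanding_space // subnKC //.
by apply: leq_trans (count_size _ _) _; case: (s j).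
Qed.

(** The less expanding space has dimension [n] minus the count, which by [expands_rank] caps every
    expanding space. *)
Lemma symmetric_coweight_expands_le n (g W : 'M[laurent k]_n) (a : seq nat) (m : nat) :
    2%:R != 0 :> k -> (0 < m)%N -> g \in unitmx -> symmetric_coweight g a ->
  expands m%:Z g^T W -> (\rank W <= count (leq m.+1) a)%N.
Proof.
move=> k2 m0 ug /(symmetric_coweight_expands k2 m0)[W1 [N [_ lessN <- rkn]]] expW.
have := expands_rank _ expW lessN; rewrite unitmx_tr => /(_ ug).
by move=> le_n; rewrite -(leq_add2r (\rank N)) rkn.
Qed.

(** For [e] false this is the number of zero entries of a sequence of length [n]. *)
Definition even_count (e : bool) n (a : seq nat) : nat :=
  if e then count (leq 1) a else (n - count (leq 1) a)%N.

Lemma even_count_sum e m (s : 'I_m -> symblock) (a : seq nat) :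
    (forall p : pred nat, count p a = (\sum_(j < m) count p (symblock_weight (s j)))%N) ->
  (\sum_(j < m) even_rank e (s j))%N =
  even_count e (\sum_(j < m) symblock_size (s j))%N a.
Proof.
move=> cnt; rewrite /even_count cnt; have -> :
    (\sum_(j < m) count (leq 1) (symblock_weight (s j)) =
     \sum_(j < m) even_rank true (s j))%N.
  by apply: eq_bigr => j _; case: (s j) => [||[|i] i1].
case: e => //; apply/eqP.
(* Each block size is the sum of its two even ranks; adding the odd one removes the truncated
   subtraction. *)
rewrite -(eqn_add2l (\sum_(j < m) even_rank true (s j))%N).
rewrite subnKC -?big_split //=; first by apply/eqP/eq_bigr => j _; case: (s j).
by apply: leq_sum => j _; case: (s j).
Qed.

(** The rows of [W] are test vectors over k((z^2)), encoded as fixed by conjugation; the rank is the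
    dimension spanned by their leading coefficients. *)
Lemma symmetric_coweight_even n (g : 'M[laurent k]_n) (a : seq nat) (e : bool) :
    symmetric_coweight g a ->
  exists W : 'M[laurent k]_n, [/\ lconjmx W = W, mxvge e%:Z (W *m g^T) &
    \rank (coefmx e%:Z (W *m g^T)) = even_count e n a].
Proof.
move=> /symmetric_coweight_tr[r] [s] [d] [H] [V] [U].
case=> [[VH HV _ cV] [uU U0 V0] -> cnt].
case: _ / d H V U VH HV cV uU U0 V0 => H V U VH HV cV uU U0 V0.
rewrite castmx_id.
pose E := \mxdiag_j even_space k e (s j).
pose S := \mxdiag_j (symblock_mx k (s j))^T; rewrite -/S.
have ES : E *m S = \mxdiag_j (even_space k e (s j) *m (symblock_mx k (s j))^T).
  exact: mul_mxdiag_mxdiag.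
have ESt : mxvge e%:Z (E *m S).
  rewrite ES; apply/mxvge_mxdiag => j.
  by have [] := symblock_even_space k e (s j).
have EVS : E *m V *m (H *m S *m U) = E *m S *m U.
  by rewrite !mulmxA -(mulmxA E) VH mulmx1.
exists (E *m V); rewrite EVS; split.
- rewrite lconjmxM cV map_mxdiag ?rmorph0 //; congr (_ *m V).
  by apply: eq_mxdiag => j; apply: conj_even_space.
- exact/mxvge_unitr.
rewrite rank_coefmx_unitr // ES map_mxdiag ?lcoef0 // rank_mxdiag -(even_count_sum e cnt).
by apply: eq_bigr => j _; have [] := symblock_even_space k e (s j).
Qed.

Lemma symmetric_coweight_even_le n (g W : 'M[laurent k]_n) (a : seq nat) (e : bool) :
    2%:R != 0 :> k -> symmetric_coweight g a ->
    lconjmx W = W -> mxvge e%:Z (W *m g^T) ->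
  (\rank (coefmx e%:Z (W *m g^T)) <= even_count e n a)%N.
Proof.
move=> k2 /symmetric_coweight_tr[r] [s] [d] [H] [V] [U].
case=> [[VH HV cH _] [uU U0 V0] -> cnt].
case: _ / d H V U W VH HV cH uU U0 V0 => H V U W VH HV cH uU U0 V0.
rewrite castmx_id; set S := \mxdiag_j _; rewrite !mulmxA => cW.
move=> /(mxvge_unitr _ _ uU U0 V0) WSt; rewrite rank_coefmx_unitr //.
have cWH : lconjmx (W *m H) = W *m H by rewrite lconjmxM cW cH.
(* The rows of [W *m H] are again fixed by conjugation, so each block can be bounded separately. *)
move: (W *m H) cWH WSt => {W cW} {}W cW.
rewrite -(submxrowK W) mul_mxrow_mxdiag map_mxrow => /mxvge_mxrow Wt.
apply: leq_trans (rank_mxrow _) _; rewrite -(even_count_sum e cnt).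
apply: leq_sum => j _; apply: even_rank_le => //.
by apply/matrixP => p q; rewrite lconjmxE mxE -{2}cW lconjmxE.
Qed.

End SymmetricCoweight.

(** * The effect of one multiplication by A *)

Section OneStep.
Variable k : fieldType.

Lemma dominant_coweight_tr n (A : 'M[laurent k]_n) (l : nat) :
  dominant_coweight A (l%:Z :: nseq n.-1 0) ->
  exists (i0 : 'I_n) (d : 'rV[laurent k]_n) (V U : 'M[laurent k]_n),
    [/\ A^T = V *m diag_mx d *m U,
        [/\ V \in unitmx, mxvge 0 V & mxvge 0 (invmx V)],
        [/\ U \in unitmx, mxvge 0 U & mxvge 0 (invmx U)],
        mxvge 0 d & forall i, i != i0 -> d 0 i = 1].
Proof.
case=> /= nE _ [u [v [uP vP ->]]].
have n0 : (0 < n)%N by rewrite -nE.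
exists (Ordinal n0), (\row_i laurentX ^ nth 0 (l%:Z :: nseq n.-1 0) i), v^T, u^T.
split; [| exact: GLn_over_int_tr | exact: GLn_over_int_tr | |].
- by rewrite !trmx_mul tr_diag_mx mulmxA.
- move=> p i; rewrite mxE; case: (val i) => [|j] /=.
    rewrite -exprnP -[_ ^+ _]mulr1.
    by apply: vge_le (proj2 (vgeXnM 0 _ _) (@vge1 k)).
  by rewrite nth_nseq if_same expr0z; apply: vge1.
move=> i; rewrite mxE -val_eqE /=; case: (nat_of_ord i) => // j _ /=.
by rewrite nth_nseq if_same expr0z.
Qed.

(* T has elementary divisors z^l, 1, ..., 1: it is integral, it preserves
   valuations on a hyperplane, and it has corank at most 1 modulo z. *)
Definition one_step n (T : 'M[laurent k]_n) : Prop :=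
  [/\ mxvge 0 T,
      exists c : 'cV[laurent k]_n, forall t (y : 'rV_n),
        y *m c = 0 -> mxvge t (y *m T) -> mxvge t y &
      (n <= (\rank (coefmx 0 T)).+1)%N].

Lemma dominant_coweight_one_step n (A : 'M[laurent k]_n) (l : nat) :
  dominant_coweight A (l%:Z :: nseq n.-1 0) -> one_step A^T.
Proof.
case/dominant_coweight_tr=> i0 [d] [V] [U] [-> [uV V0 iV0] [uU U0 iU0] d0 d1].
have D0 : mxvge 0 (diag_mx d).
  by move=> i j; rewrite mxE; case: eqP => _; [exact: d0 | exact: vge0].
have VD0 : mxvge 0 (V *m diag_mx d) by rewrite -[0]addr0; apply: mxvgeM.
split; first by rewrite -[0]addr0; apply: mxvgeM.
  exists (col i0 V) => t y yV.
  rewrite mulmxA => /(mxvge_unitr _ _ uU U0 iU0); rewrite mulmxA => yVDt.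
  apply/(mxvge_unitr _ _ uV V0 iV0) => p j; rewrite [p]ord1 {p}.
  have [->|/d1 dj] := eqVneq j i0.
    have -> : (y *m V) 0 i0 = (y *m col i0 V) 0 0.
      by rewrite !mxE; apply: eq_bigr => q _; rewrite mxE.
    by rewrite yV mxE; apply: vge0.
  by have := yVDt 0 j; rewrite mul_mx_diag mxE dj mulr1.
rewrite rank_coefmx_unitr //; have := coefmxM V0 D0; rewrite addr0 => ->.
have := coefmx0_unit V0 iV0 (mulmxV uV); rewrite -row_full_unit => fV.
rewrite (eqmxMfull _ fV).
(* Modulo z the diagonal factor is the identity minus a matrix of rank at most 1. *)
have -> : coefmx 0 (diag_mx d) = 1%:M - (1 - d 0 i0 0) *: delta_mx i0 i0.
  apply/matrixP => i j; rewrite !mxE.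
  have [->|ij] := eqVneq i j; last first.
    rewrite lcoef0 mulr0n [_ && _](_ : _ = false) ?mulr0 ?subr0 //.
    by apply/negP => /andP[/eqP ii /eqP ji]; rewrite ii ji eqxx in ij.
  rewrite andbb; have [->|/d1 ->] := eqVneq j i0.
    by rewrite mulr1 opprB addrC subrK.
  by rewrite mulr0 subr0 mulr1n lcoef1 eqxx.
set N := _ *: _; have rN : (\rank N <= 1)%N.
  by apply: leq_trans (mxrank_scale _ _) _; rewrite mxrank_delta.
have := mxrank_add (1%:M - N) N; rewrite subrK mxrank1 => le_n.
by apply: leq_trans le_n _; rewrite -addn1 leq_add2l.
Qed.

Lemma rank_cap_ker (F : fieldType) n (W : 'M[F]_n) (c : 'cV[F]_n) :
  (\rank W <= (\rank (W :&: kermx c)%MS).+1)%N.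
Proof.
by have := mxrank_mul_ker W c; have := rank_leq_col (W *m c); lia.
Qed.

Lemma expands_mulr n (G T W : 'M[laurent k]_n) m :
    one_step T -> expands m G W ->
  exists W', expands m (G *m T) W' /\ (\rank W <= (\rank W').+1)%N.
Proof.
case=> T0 [c cP] _ expW.
(* The equation says x' G c = 0, so a bound on x' G T descends to x' G; integrality of [T] then
   carries the bound on x G over to x G T. *)
exists (W :&: kermx (lconjmx (G *m c)))%MS; split; last exact: rank_cap_ker.
move=> t x; rewrite sub_capmx => /andP[xW /sub_kermxP xc] xt.
rewrite mulmxA -[t + m]addr0; apply: mxvgeM T0; apply: expW xW _.
apply: cP; last by rewrite -mulmxA.
by rewrite -mulmxA -[G *m c]lconjmxK -lconjmxM xc map_mx0.
Qed.

Lemma expands_mulr_inv n (G T W : 'M[laurent k]_n) m :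
    one_step T -> expands m (G *m T) W ->
  exists W', expands m G W' /\ (\rank W <= (\rank W').+1)%N.
Proof.
case=> T0 [c cP] _ expW.
(* Now [T] is to be removed from x G T, so the equation is imposed on x G instead of x' G. *)
exists (W :&: kermx (G *m c))%MS; split; last exact: rank_cap_ker.
move=> t x; rewrite sub_capmx => /andP[xW /sub_kermxP xc] xt.
apply: cP; first by rewrite -mulmxA.
rewrite -mulmxA; apply: expW xW _.
by rewrite mulmxA -[t]addr0; apply: mxvgeM T0.
Qed.

Lemma rank_coefmx_mulr n t (Y T : 'M[laurent k]_n) :
    one_step T -> mxvge t Y ->
  (\rank (coefmx t Y) <= (\rank (coefmx t (Y *m T))).+1)%N.
Proof.
case=> T0 _ rT Yt; have := coefmxM Yt T0; rewrite addr0 => ->.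
(* With middle factor 1 this is Sylvester's rank inequality; [T] has corank at most 1 modulo z. *)
have := mxrank_Frobenius (coefmx t Y) 1%:M (coefmx 0 T).
rewrite mulmx1 mul1mx mxrank1 => le_n.
rewrite -(leq_add2r (\rank (coefmx 0 T))); apply: leq_trans le_n _.
by rewrite addSnnS addnC leq_add2l.
Qed.

Lemma count_coweight_mul n (A B : 'M[laurent k]_n) (a b : seq nat) (l t : nat) :
    2%:R != 0 :> k -> A \in unitmx -> B \in unitmx ->
    dominant_coweight A (l%:Z :: nseq n.-1 0) ->
    symmetric_coweight B a -> symmetric_coweight (A *m B) b -> (0 < t)%N ->
  (count (leq t) a <= (count (leq t) b).+1)%N /\
  (count (leq t) b <= (count (leq t) a).+1)%N.
Proof.
move=> k2 uA uB /dominant_coweight_one_step stepA sa sb.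
have uAB : A *m B \in unitmx by rewrite unitmx_mul uA.
case: t => // -[_|m _].
  (* The case [e] true compares the numbers of positive entries; [e] false compares the zeros, which
     gives the opposite inequality. *)
  have le_even e : (even_count e n a <= (even_count e n b).+1)%N.
    have [W [cW Wt <-]] := symmetric_coweight_even e sa.
    apply: leq_trans (rank_coefmx_mulr stepA Wt) _; rewrite ltnS -mulmxA -trmx_mul.
    apply: symmetric_coweight_even_le => //.
    by rewrite trmx_mul mulmxA -[e%:Z]addr0; case: stepA => A0 _ _; apply: mxvgeM.
  have count_le c (g : 'M[laurent k]_n) :
      symmetric_coweight g c -> (count (leq 1) c <= n)%N.
    case/(symmetric_coweight_even true) => W [_ _]; rewrite /even_count => <-.
    exact: rank_leq_row.
  have := le_even true; have := le_even false; rewrite /even_count.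
  have := count_le _ _ sa; have := count_le _ _ sb; lia.
(* Entries at least t = m + 2 are detected by a gain of m + 1. *)
have [Wa [_ [expa _ rka _]]] := symmetric_coweight_expands k2 (ltn0Sn m) sa.
have [Wb [_ [expb _ rkb _]]] := symmetric_coweight_expands k2 (ltn0Sn m) sb.
split.
  have [W' [expW' leW']] := expands_mulr stepA expa.
  rewrite -rka; apply: leq_trans leW' _; rewrite -trmx_mul in expW'.
  by rewrite ltnS; apply: symmetric_coweight_expands_le sb expW'.
rewrite trmx_mul in expb; have [W' [expW' leW']] := expands_mulr_inv stepA expb.
rewrite -rkb; apply: leq_trans leW' _.
by rewrite ltnS; apply: symmetric_coweight_expands_le sa expW'.
Qed.

End OneStep.

(** * From counts to entries of decreasing sequences *)

(** The entries at least [t] form an initial segment. For positive [t] the default 0 past the end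
    fails the bound, as it should. *)
Lemma leq_nth_sorted (s : seq nat) (t i : nat) :
  sorted geq s -> (0 < t)%N -> (t <= nth 0%N s i)%N = (i < count (leq t) s)%N.
Proof.
move=> + t0; elim: s i => [|x s IHs] i /=; first by rewrite nth_nil; lia.
rewrite path_sortedE; last by move=> y x' z /= ? ?; lia.
case/andP=> /allP xs ss; case: i => [|i] /=; last first.
  rewrite IHs //; have [tx|xt] := leqP t x; first by [].
  rewrite add0n (_ : count _ _ = 0%N) //; apply/eqP; rewrite -leqn0 leqNgt -has_count.
  by apply/hasPn => y /xs /=; lia.
have [tx|xt] := leqP t x; first by [].
rewrite add0n (_ : count _ _ = 0%N) //; apply/eqP; rewrite -leqn0 leqNgt -has_count.
by apply/hasPn => y /xs /=; lia.
Qed.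

Lemma leq_nth_count (s1 s2 : seq nat) (i : nat) :
    sorted geq s1 -> sorted geq s2 ->
    (forall t, (0 < t)%N -> (count (leq t) s1 <= (count (leq t) s2).+1)%N) ->
  (nth 0%N s1 i.+1 <= nth 0%N s2 i)%N.
Proof.
move=> ss1 ss2 le12; case t0: (nth 0%N s1 i.+1) => [|t] //.
(* Taking the value of [s1] at i + 1 as threshold, more than i + 1 entries of [s1], hence more than
   i entries of [s2], reach it. *)
rewrite leq_nth_sorted //; have := leq_nth_sorted i.+1 ss1 (ltn0Sn t).
by have := le12 t.+1 isT; lia.
Qed.

Lemma symmetric_coweight_sorted (k : fieldType) n (g : 'M[laurent k]_n) a :
  symmetric_coweight g a -> sorted geq a.
Proof.
case=> m [s] [e] [u] [h] [_ _ _ ->].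
by apply: sort_sorted => x y; rewrite /= leq_total.
Qed.

(* Sequences are indexed from 0: nth 0 a i is a_{i+1}. *)
Theorem theorem2p3 (k : finFieldType) (n l : nat)
    (A B : 'M[laurent k]_n) (a b : seq nat) :
  2%N \notin [pchar k] ->
  A \in unitmx ->
  B \in unitmx ->
  dominant_coweight A (l%:Z :: nseq n.-1 0) ->
  symmetric_coweight B a ->
  symmetric_coweight (A *m B) b ->
  (forall i : nat, (i.+1 < n)%N -> (nth 0%N a i.+1 <= nth 0%N b i)%N) /\
  (forall i : nat, (i.+1 < n)%N -> (nth 0%N b i.+1 <= nth 0%N a i)%N).
Proof.
rewrite inE /= => k2 uA uB rhoA sa sb.
have cnt t := count_coweight_mul k2 uA uB rhoA sa sb (t := t).
have [sorta sortb] := (symmetric_coweight_sorted sa, symmetric_coweight_sorted sb).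
by split=> i _; apply: leq_nth_count => // t /cnt[].
Qed.
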